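(* Let $\Bbbk$ be a field and let $A$ be a left (or right) noetherian $\Bbbk$-algebra whose center is artinian. Then $A$ is Morita cancellative. As a consequence, every finite dimensional $\Bbbk$-algebra is Morita cancellative.
   Context: $\Bbbk$ is a base field and everything is over $\Bbbk$: all algebras are unital associative $\Bbbk$-algebras. $A[t]$ denotes the polynomial algebra obtained from $A$ by adjoining a central indeterminate. $M(A)$ denotes the category of right $A$-modules. Morita cancellative: $A$ is Morita cancellative if, for every algebra $B$, an equivalence of categories between $M(A[t])$ and $M(B[t])$ implies that $M(A)$ is equivalent to $M(B)$. *)

(* Defs.v *)
From HB Require Import structures.
From mathcomp Require Import all_boot all_algebra all_field.
From mathcomp Require Import boolp classical_sets.

Set Implicit Arguments.
Unset Strict Implicit.
Unset Printing Implicit Defensive.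

Import GRing.Theory.
Local Open Scope classical_set_scope.
Local Open Scope ring_scope.

Record left_ideal (R : pzRingType) (I : set R) : Prop := LeftIdeal {
  left_ideal0 : I 0;
  left_idealD : forall x y, I x -> I y -> I (x + y);
  left_idealM : forall a x, I x -> I (a * x) }.

Definition left_noetherian (R : pzRingType) : Prop :=
  forall I : nat -> set R, (forall n, left_ideal (I n)) ->
    (forall n, I n `<=` I n.+1) ->
    exists n, forall m, (n <= m)%N -> I m = I n.

Definition right_noetherian (R : pzRingType) : Prop := left_noetherian R^c.

Definition artinian (R : comPzRingType) : Prop :=
  forall I : nat -> set R, (forall n, left_ideal (I n)) ->
    (forall n, I n.+1 `<=` I n) ->
    exists n, forall m, (n <= m)%N -> I m = I n.

Definition central_pred (R : nzRingType) : {pred R} :=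
  fun x => `[< forall y, GRing.comm x y >].

Lemma central_subring (R : nzRingType) : subring_closed (@central_pred R).
Proof.
split=> [|x y /asboolP Cx /asboolP Cy|x y /asboolP Cx /asboolP Cy];
  apply/asboolP=> z.
- exact/commr_sym/commr1.
- by apply/commr_sym/commrB; apply/commr_sym.
- by apply/commr_sym/commrM; apply/commr_sym.
Qed.

HB.instance Definition _ (R : nzRingType) :=
  GRing.isSubringClosed.Build R (@central_pred R) (@central_subring R).

Record center (R : nzRingType) : Type := Center {
  center_val :> R;
  center_valP : center_val \in @central_pred R }.

HB.instance Definition _ (R : nzRingType) := [isSub for @center_val R].
HB.instance Definition _ (R : nzRingType) := [Choice of center R by <:].
HB.instance Definition _ (R : nzRingType) :=
  [SubChoice_isSubNzRing of center R by <:].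

Lemma center_mulC (R : nzRingType) : commutative (@GRing.mul (center R)).
Proof.
move=> x y; apply: val_inj; rewrite !rmorphM /=.
by have /asboolP := center_valP x; apply.
Qed.

HB.instance Definition _ (R : nzRingType) :=
  GRing.PzRing_hasCommutativeMul.Build (center R) (@center_mulC R).

(* MathComp only equips {poly A} with scalars in A itself, hence this alias for
   A[t] viewed as an algebra over k. *)

Definition polyalg (k : fieldType) (A : algType k) : Type := {poly A}.

Section PolyAlg.
Variables (k : fieldType) (A : algType k).

HB.instance Definition _ := GRing.NzRing.on (polyalg A).

Definition polyalg_scale (c : k) (p : polyalg A) : polyalg A :=
  (c%:A : A) *: (p : {poly A}).

Fact polyalg_scaleA a b p :
  polyalg_scale a (polyalg_scale b p) = polyalg_scale (a * b) p.
Proof. by rewrite /polyalg_scale scalerA mulr_algl scalerA. Qed.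

Fact polyalg_scale1 : left_id 1 polyalg_scale.
Proof. by move=> p; rewrite /polyalg_scale !scale1r. Qed.

Fact polyalg_scaleDr : right_distributive polyalg_scale +%R.
Proof. by move=> a p q; apply: scalerDr. Qed.

Fact polyalg_scaleDl p : {morph polyalg_scale^~ p : a b / a + b}.
Proof. by move=> a b; rewrite /polyalg_scale !scalerDl. Qed.

HB.instance Definition _ :=
  GRing.Zmodule_isLmodule.Build k (polyalg A)
    polyalg_scaleA polyalg_scale1 polyalg_scaleDr polyalg_scaleDl.

Fact polyalg_scaleAl (a : k) (p q : polyalg A) : a *: (p * q) = (a *: p) * q.
Proof. exact: (@scalerAl _ {poly A}). Qed.

HB.instance Definition _ :=
  GRing.Lmodule_isLalgebra.Build k (polyalg A) polyalg_scaleAl.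

Fact polyalg_scaleAr (a : k) (p q : polyalg A) : a *: (p * q) = p * (a *: q).
Proof.
apply/polyP=> i; rewrite coefZ !coefM mulr_sumr; apply: eq_bigr => j _.
by rewrite coefZ !mulr_algl scalerAr.
Qed.

HB.instance Definition _ :=
  GRing.Lalgebra_isAlgebra.Build k (polyalg A) polyalg_scaleAr.

End PolyAlg.

(* M(A): right A-modules are left modules over the converse ring A^c, with
   (a : A^c) *: x standing for x a. *)

Notation rmodType A := (lmodType (A : nzRingType)^c).

(* Equality of morphisms is pointwise equality, hence the field fmap_ext. *)
Record functor (k : fieldType) (A B : algType k) := Functor {
  fobj :> rmodType A -> rmodType B;
  fmap : forall M N : rmodType A, {linear M -> N} -> {linear fobj M -> fobj N};
  fmap_ext : forall (M N : rmodType A) (f g : {linear M -> N}),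
    f =1 g -> fmap f =1 fmap g;
  fmap_id : forall M : rmodType A,
    fmap (idfun : {linear M -> M}) =1 idfun;
  fmap_comp : forall (M N P : rmodType A)
    (g : {linear N -> P}) (f : {linear M -> N}),
    fmap (g \o f : {linear M -> P}) =1 fmap g \o fmap f }.

Arguments fmap {k A B} F {M N} f : rename.
Arguments fmap_ext {k A B} F {M N f g} _ : rename.
Arguments fmap_id {k A B} F M : rename.
Arguments fmap_comp {k A B} F {M N P} g f : rename.

Section Functors.
Variables (k : fieldType) (A B C : algType k).

Definition functor_id : functor A A :=
  @Functor k A A id (fun M N f => f) (fun _ _ _ _ e => e)
    (fun _ _ => erefl) (fun _ _ _ _ _ _ => erefl).

Fact functor_comp_ext (G : functor B C) (F : functor A B)
    (M N : rmodType A) (f g : {linear M -> N}) :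
  f =1 g -> fmap G (fmap F f) =1 fmap G (fmap F g).
Proof. by move=> e; apply/fmap_ext/fmap_ext. Qed.

Fact functor_comp_id (G : functor B C) (F : functor A B) (M : rmodType A) :
  fmap G (fmap F (idfun : {linear M -> M})) =1 idfun.
Proof.
move=> x; rewrite -[RHS](fmap_id G (F M)).
by apply: fmap_ext; apply: fmap_id.
Qed.

Fact functor_comp_comp (G : functor B C) (F : functor A B)
    (M N P : rmodType A) (g : {linear N -> P}) (f : {linear M -> N}) :
  fmap G (fmap F (g \o f : {linear M -> P})) =1
  fmap G (fmap F g) \o fmap G (fmap F f).
Proof.
move=> x; rewrite -[RHS](fmap_comp G).
by apply: fmap_ext; apply: fmap_comp.
Qed.

Definition functor_comp (G : functor B C) (F : functor A B) : functor A C :=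
  @Functor k A C (fun M => G (F M)) (fun M N f => fmap G (fmap F f))
    (@functor_comp_ext G F) (@functor_comp_id G F) (@functor_comp_comp G F).

Definition nat_iso (F G : functor A B) : Prop :=
  exists (eta : forall M, {linear F M -> G M})
         (eps : forall M, {linear G M -> F M}),
    [/\ forall M, cancel (eta M) (eps M),
        forall M, cancel (eps M) (eta M)
      & forall (M N : rmodType A) (f : {linear M -> N}),
          eta N \o fmap F f =1 fmap G f \o eta M].

(* The scalar c acts on a right A-module through c%:A; the k-linear structure
   on Hom(M, N) is pointwise, so that h below is the morphism c f + g. *)
Definition linear_functor (F : functor A B) : Prop :=
  forall (M N : rmodType A) (c : k) (f g h : {linear M -> N}),
    (forall x, h x = (c%:A : A^c) *: f x + g x) ->
    forall y, fmap F h y = (c%:A : B^c) *: fmap F f y + fmap F g y.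

End Functors.

Definition is_equivalence (k : fieldType) (A B : algType k)
    (F : functor A B) : Prop :=
  exists G : functor B A,
    nat_iso (functor_comp G F) (functor_id A) /\
    nat_iso (functor_comp F G) (functor_id B).

Definition morita_equivalent (k : fieldType) (A B : algType k) : Prop :=
  exists F : functor A B, is_equivalence F.

Definition klinear_morita_equivalent (k : fieldType) (A B : algType k) : Prop :=
  exists F : functor A B, linear_functor F /\ is_equivalence F.

(* The two definitions below differ in what an equivalence between the module
   categories of two k-algebras is: one of plain categories, or one of
   k-linear categories.  Neither property formally implies the other. *)

Definition morita_cancellative (k : fieldType) (A : algType k) : Prop :=
  forall B : algType k,
    morita_equivalent (polyalg A) (polyalg B) -> morita_equivalent A B.

Definition klinear_morita_cancellative (k : fieldType) (A : algType k) : Prop :=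
  forall B : algType k,
    klinear_morita_equivalent (polyalg A) (polyalg B) ->
    klinear_morita_equivalent A B.

(* Main.v *)
Require Import Defs.
From HB Require Import structures.
From mathcomp Require Import all_boot all_algebra all_field.
From mathcomp Require Import ring_quotient boolp classical_sets.

(** The point is that an equivalence between the modules over A[t] and B[t]
transports the indeterminate to t - b, for a central b in B, up to a unit.

An equivalence F from M(A[t]) to M(B[t]) carries the action of a central element
of A[t] to that of a central element of B[t], since the center of a ring is the
ring of natural endomorphisms of the identity functor of its modules
(fmap_central_map).  Equivalences preserve sums of morphisms (fmap_add), so this
is a ring morphism phi from Z(A)[t] to Z(B)[t]; a quasi-inverse of F provides
preimages, so phi is onto (poly_center_transfer).

Let f = phi(t).  When Z(A) is artinian, every x in Z(A) is pi-regular: some x^n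
is a multiple of x^(n+1) (artinian_pi_regular).  For every prime ideal P of Z(B)
with quotient domain D, the induced map from Z(A)[t] onto D[t] sends pi-regular
elements to zero or to units, hence sends Z(A) to constants.  So t is obtained
by substituting f mod P into a polynomial over D, and f mod P has degree one
(size_image_polyX).  As P varies this says that the coefficient of degree one in
f is invertible and that the higher ones are nilpotent
(quasilinear_image_polyX).  Newton iteration then stops at an exact root b of f,
and f = (t - b) g with g invertible (quasilinear_factor).

Now M(A) is the full subcategory of M(A[t]) on the modules killed by t, and F
matches these with the modules over B[t] killed by f, which are those killed by
t - b, on which t acts as the central element b; they form M(B) again
(at_value_forget).  So F restricts to an equivalence from M(A) to M(B), given
explicitly by descend; restriction functors being k-linear, it is k-linear when
F is.

For a finite dimensional A the same argument applies, the center being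
pi-regular because the powers of an element are linearly dependent
(falg_center_pi_regular). *)

Set Implicit Arguments.
Unset Strict Implicit.
Unset Printing Implicit Defensive.

Import GRing.Theory.
Local Open Scope classical_set_scope.
Local Open Scope ring_scope.

(** For a commutative ring this says that the Krull dimension is zero. *)
Definition pi_regular (R : comNzRingType) : Prop :=
  forall x : R, exists n y, x ^+ n = x ^+ n.+1 * y.

Definition surjective (T U : Type) (f : T -> U) : Prop :=
  forall y, exists x, f x = y.

(** * Nilpotent elements and the factorization of quasilinear polynomials *)

Section Nilpotent.
Variable S : comNzRingType.

Definition nilpot (x : S) : Prop := exists n, x ^+ n = 0.
Definition invertible (x : S) : Prop := exists y, x * y = 1.

Lemma nilpot0 : nilpot 0.
Proof. by exists 1%N; rewrite expr1. Qed.

Lemma nilpotD x y : nilpot x -> nilpot y -> nilpot (x + y).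
Proof.
move=> [m xm] [n yn]; exists (m + n)%N.
have expr0_le (z : S) p q : (p <= q)%N -> z ^+ p = 0 -> z ^+ q = 0.
  by move=> pq zp; rewrite -(subnK pq) exprD zp mulr0.
rewrite exprDn big1 // => i _; case: (leqP i n) => [le_in|/ltnW lt_ni].
  by rewrite (expr0_le _ _ _ _ xm) ?mul0r ?mul0rn // -addnBA // leq_addr.
by rewrite (expr0_le _ _ _ lt_ni yn) mulr0 mul0rn.
Qed.

Lemma nilpotMl x y : nilpot y -> nilpot (x * y).
Proof. by move=> [n yn]; exists n; rewrite exprMn yn mulr0. Qed.

Lemma nilpot_sum (I : Type) (r : seq I) (F : I -> S) :
  (forall i, nilpot (F i)) -> nilpot (\sum_(i <- r) F i).
Proof.
by move=> nF; elim/big_ind: _ => //; [exact: nilpot0|exact: nilpotD].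
Qed.

Lemma invertible_addnil x y : invertible x -> nilpot y -> invertible (x + y).
Proof.
move=> [v xv] /(nilpotMl (- v)) [n yn].
exists (v * \sum_(i < n) (- v * y) ^+ i); rewrite mulrA mulrDl xv.
have -> : 1 + y * v = 1 - (- v * y) by rewrite mulNr opprK [v * y]mulrC.
by rewrite -opprB mulNr -subrX1 yn sub0r opprK.
Qed.
End Nilpotent.

Section Quasilinear.
Variable S : comNzRingType.
Implicit Types f g : {poly S}.

Lemma nilpot_poly f : (forall i, nilpot f`_i) -> nilpot f.
Proof.
move=> nf; rewrite -(coefK f) poly_def; apply: nilpot_sum => i.
rewrite -mul_polyC mulrC; apply: nilpotMl; have [n fn] := nf i.
by exists n; rewrite -rmorphXn /= fn.
Qed.

Lemma invertible_poly g :
  invertible g`_0 -> (forall i, nilpot g`_i.+1) -> invertible g.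
Proof.
move=> [v gv] ng; rewrite -[g](subrKC (g`_0)%:P).
apply: invertible_addnil; first by exists v%:P; rewrite -rmorphM /= gv.
apply: nilpot_poly => -[|i]; rewrite coefB coefC /= ?subrr ?subr0 //.
exact: nilpot0.
Qed.

Lemma horner_expansion f c : exists g, f = f.[c]%:P + ('X - c%:P) * g.
Proof.
have /factor_theorem [g fg] : root (f - f.[c]%:P) c.
  by rewrite /root hornerD hornerN hornerC subrr.
by exists g; rewrite mulrC -fg addrC subrK.
Qed.

(** Comparing coefficients in the expansion of f around c gives
g_i = f_(i+1) + c g_(i+1), and g_i = 0 for large i; so g_i is nilpotent for
i >= 1, by descending induction, while g_0 is f_1 plus a nilpotent element. *)
Lemma quotient_invertible f g c :
  invertible f`_1 -> (forall i, nilpot f`_i.+2) ->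
  f = f.[c]%:P + ('X - c%:P) * g -> invertible g.
Proof.
move=> f1 nf fg.
have g_rec i : g`_i = f`_i.+1 + c * g`_i.+1.
  by rewrite {1}fg coefD coefC /= add0r mulrBl coefB coefXM coefCM /= subrK.
have ng i : nilpot g`_i.+1.
  have [m] := ubnP (size g - i); elim: m i => // m IHm i le_m.
  have [le_gi|lt_ig] := leqP (size g) i.+1.
    by rewrite nth_default //; apply: nilpot0.
  rewrite g_rec; apply: nilpotD => //; apply/nilpotMl/IHm.
  by rewrite subnS -ltnS (leq_trans _ le_m) // prednK // subn_gt0 ltnW.
apply: invertible_poly => //; rewrite g_rec.
by apply: invertible_addnil => //; apply: nilpotMl.
Qed.

(** A form of Hensel's lemma.  The solution of the linear part of f is a root of
f up to a nilpotent error, and each Newton step squares the error, so that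
finitely many steps lead to an exact root c.  The cofactor of 'X - c is then
invertible whatever c is. *)
Lemma quasilinear_factor f :
  invertible f`_1 -> (forall i, nilpot f`_i.+2) ->
  exists c g, f = ('X - c%:P) * g /\ invertible g.
Proof.
move=> f1 nf.
suff [c fc] : exists c, f.[c] = 0.
  have [g fg] := horner_expansion f c; exists c, g.
  by split; [rewrite {1}fg fc add0r|exact: quotient_invertible fg].
have [v fv] := f1.
have [n] : nilpot f.[- (f`_0 * v)].
  have lt1f : (1 < size f)%N.
    rewrite ltnNge; apply/negP => le_f1.
    by move/eqP: fv; rewrite nth_default // mul0r eq_sym oner_eq0.
  rewrite horner_coef -(subnKC lt1f) !big_ord_recl /= expr0 expr1 mulr1 addrA.
  rewrite mulrN mulrCA fv mulr1 subrr add0r.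
  by apply: nilpot_sum => i; rewrite mulrC; apply: nilpotMl.
(* The error f(c) is killed by a power of two, as needed for an induction in
   which f(c) is replaced by a multiple of its square. *)
move: (- _) => c fcn.
have {fcn} : f.[c] ^+ (2 ^ n) = 0.
  by rewrite -(subnK (ltnW (ltn_expl n (ltnSn 1)))) exprD fcn mulr0.
elim: n c => [|n IHn] c fcn; first by exists c.
have [g fg] := horner_expansion f c.
have [u gu] := quotient_invertible f1 nf fg.
have [k gk] := horner_expansion g c.
pose w := u.[c]; have gw : g.[c] * w = 1 by rewrite -hornerM gu hornerC.
(* Since f = f(c) + ('X - c) g, this h is the Newton correction: g(c) is the
   value of the derivative of f at c. *)
pose h := - (f.[c] * w).
apply: (IHn (c + h)).
have -> : f.[c + h] = f.[c] ^+ 2 * (w ^+ 2 * k.[c + h]).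
  rewrite {1}fg hornerD hornerC hornerM hornerXsubC.
  rewrite {1}gk hornerD hornerC hornerM hornerXsubC.
  have -> : c + h - c = h by rewrite addrAC subrr add0r.
  rewrite mulrDr addrA {1}/h mulNr mulrAC -mulrA gw mulr1 subrr add0r.
  by rewrite mulrA -expr2 /h sqrrN exprMn mulrA.
by rewrite exprMn -exprM -expnS fcn mul0r.
Qed.
End Quasilinear.

(** * Homomorphisms to integral domains *)

Section PrimeQuotient.
Variables (S : comNzRingType) (P : prime_idealr S).

(** An integral domain carries by definition a decidable set of units with an
inverse function, which the quotient by a prime ideal gets here by choice. *)
Definition prime_quot : Type := {ideal_quot P}.
HB.instance Definition _ := GRing.ComNzRing.on prime_quot.
Implicit Types x y : prime_quot.

Definition prime_quot_unit : {pred prime_quot} :=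
  fun x => `[< exists y, y * x = 1 >].

Definition prime_quot_inv x : prime_quot :=
  if pselect (exists y, y * x = 1) is left invx then projT1 (cid invx) else x.

Fact prime_quot_mulVx : {in prime_quot_unit, left_inverse 1 prime_quot_inv *%R}.
Proof.
move=> x /asboolP xU; rewrite /prime_quot_inv.
by case: pselect => // invx; case: cid.
Qed.

Fact prime_quot_unitPl x y : y * x = 1 -> prime_quot_unit x.
Proof. by move=> yx; apply/asboolP; exists y. Qed.

Fact prime_quot_invr_out : {in [predC prime_quot_unit], prime_quot_inv =1 id}.
Proof.
move=> x /asboolPn nU; rewrite /prime_quot_inv.
by case: pselect.
Qed.

HB.instance Definition _ := GRing.ComNzRing_hasMulInverse.Build prime_quot
  prime_quot_mulVx prime_quot_unitPl prime_quot_invr_out.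
HB.instance Definition _ := GRing.ComUnitRing_isIntegral.Build prime_quot
  (@Quotient.rquot_IdomainAxiom S P).

Lemma prime_quotient :
  exists (D : idomainType) (pi : {rmorphism S -> D}),
    surjective pi /\ forall s, (pi s == 0) = (s \in P).
Proof.
exists prime_quot, (\pi_{ideal_quot P}%qT : {rmorphism S -> {ideal_quot P}}).
split=> [y|s].
  by exists (generic_quotient.repr y); apply: generic_quotient.reprK.
by rewrite -[s in RHS]subr0 Quotient.idealrBE rmorph0.
Qed.
End PrimeQuotient.

Section PrimeAvoidance.
Variable S : comNzRingType.

(** By Zorn's lemma there is an ideal that is maximal among those that contain I
and no power of x; it is prime, and the domain is the quotient by it. *)
Lemma domain_avoiding (I : set S) (x : S) :
  left_ideal I -> (forall n, ~ I (x ^+ n)) ->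
  exists (D : idomainType) (pi : {rmorphism S -> D}),
    [/\ surjective pi, forall y, I y -> pi y = 0 & pi x != 0].
Proof.
move=> idI Ix.
pose avoids (J : set S) := left_ideal J /\ forall n, ~ J (x ^+ n).
(* Zorn's lemma is applied to the sets whose union with I is such an ideal,
   rather than to the ideals themselves, because the union of the empty chain
   is empty. *)
have [F chainF totF|A [[idJ Jx] maxA]] :=
    @Zorn_bigcup S [set J | avoids (I `|` J)].
  split=> [|n [/Ix//|[J JF Jx]]]; last first.
    by apply: (chainF J JF).2; right; apply: Jx.
  split=> [|y z|a y].
  - by left; exact: left_ideal0 idI.
  - have big J : F J -> (I `|` J) y -> (I `|` J) z ->
        (I `|` \bigcup_(X in F) X) (y + z).
      move=> FJ Jy Jz; have [idJ _] := chainF J FJ.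
      by have [] := left_idealD idJ Jy Jz; [left|right; exists J].
    case=> [Iy|[J FJ Jy]] [Iz|[K FK Kz]].
    + by left; apply: left_idealD.
    + by apply: (big K) => //; [left|right].
    + by apply: (big J) => //; [right|left].
    + have [JK|KJ] := totF J K FJ FK.
      * by apply: (big K) => //; right=> //; apply: JK.
      * by apply: (big J) => //; right=> //; apply: KJ.
  case=> [Iy|[J FJ Jy]]; first by left; apply: left_idealM.
  have [idJ _] := chainF J FJ.
  by have [] := left_idealM idJ a (or_intror Jy); [left|right; exists J].
set J := I `|` A in idJ Jx.
have max_pow y : ~ J y -> exists n a j, J j /\ x ^+ n = j + a * y.
  move=> nJy; pose K z := exists a j, J j /\ z = j + a * y.
  have JK : J `<=` K by move=> j Jj; exists 0, j; rewrite mul0r addr0.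
  have IUK : I `|` K = K by apply/setUidr => z Iz; apply: JK; left.
  have idK : left_ideal K.
    split=> [|_ _ [a [j [Jj ->]]] [b [i [Ji ->]]]|b _ [a [j [Jj ->]]]].
    - by apply: JK; exact: left_ideal0 idJ.
    - exists (a + b), (j + i); rewrite mulrDl addrACA; split=> //.
      exact: left_idealD.
    - exists (b * a), (b * j); rewrite mulrDr mulrA; split=> //.
      exact: left_idealM.
  apply: contrapT => nK; apply: (maxA K).
    split=> [z Az|/(_ y) KA]; first by apply: JK; right.
    apply: nJy; right; apply: KA; exists 1, 0; rewrite add0r mul1r.
    by split=> //; apply: left_ideal0.
  rewrite /= IUK; split=> // n [a [j [Jj e]]].
  by apply: nK; exists n, a, j.
pose p : S -> bool := fun y => `[< J y >].
have p_ideal : idealr_closed (p : {pred S}).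
  split=> [||a y z /asboolP Jy /asboolP Jz].
  - by apply/asboolP; exact: left_ideal0 idJ.
  - by apply/asboolP; rewrite -(expr0 x); apply: Jx.
  - by apply/asboolP; apply: (left_idealD idJ) => //; apply: left_idealM.
have p_prime : prime_idealr_closed (p : {pred S}).
  move=> y z /asboolP Jyz; apply/orP; apply: contrapT => nor.
  have [nJy nJz] : ~ J y /\ ~ J z.
    by split=> Jt; apply: nor; [left|right]; apply/asboolP.
  have [m [a [i [Ji xm]]]] := max_pow _ nJy.
  have [n [b [j [Jj xn]]]] := max_pow _ nJz.
  apply: (Jx (m + n)%N); rewrite exprD xm xn mulrDl.
  apply: left_idealD => //; first by rewrite mulrC; apply: left_idealM.
  rewrite mulrDr; apply: left_idealD => //; first exact: left_idealM.
  by rewrite mulrACA; apply: left_idealM.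
pose pI := isIdealr.Build S p p_ideal.
pose pP := isPrimeIdealrClosed.Build S p p_prime.
pose P : prime_idealr S := HB.pack p pI pP.
have [D [pi [surj_pi pi_eq0]]] := prime_quotient P.
exists D, pi; split=> // [y Iy|]; last first.
  by rewrite pi_eq0; apply/asboolP; rewrite -(expr1 x); apply: Jx.
by apply/eqP; rewrite pi_eq0; apply/asboolP; left.
Qed.
End PrimeAvoidance.

(** * The image of the indeterminate *)

Section PiRegular.
Variable R : comNzRingType.
Hypothesis regR : pi_regular R.

(** In a domain a pi-regular element is zero or a unit, and the units of D[t]
are constants. *)
Lemma pi_regular_constant (D : idomainType)
    (phi : {rmorphism R -> {poly D}}) r :
  exists d, phi r = d%:P.
Proof.
have [n [y xn]] := regR r.
have [->|nz_r] := eqVneq (phi r) 0; first by exists 0.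
suff: phi r * phi y = 1.
  move=> e; have : size (phi r * phi y) == 1%N by rewrite e size_poly1.
  by rewrite size_mul_eq1 => /andP [/size_poly1P [d _ ->] _]; exists d.
apply: (mulfI (expf_neq0 n nz_r)).
by rewrite mulr1 mulrA -exprSr -!rmorphXn -rmorphM -xn.
Qed.

(** Scalars go to constants, so a preimage p of 'X shows that 'X is a polynomial
in phi 'X with coefficients in D; degrees multiply under composition, hence
phi 'X has degree one. *)
Lemma size_image_polyX (D : idomainType)
    (phi : {rmorphism {poly R} -> {poly D}}) :
  surjective phi -> size (phi 'X) = 2%N.
Proof.
move=> surj_phi; have [p phi_p] := surj_phi 'X.
have [d phi_d] := choice (pi_regular_constant (phi \o polyC)).
pose g := \poly_(i < size p) d p`_i.
have : g \Po phi 'X = 'X.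
  rewrite -phi_p -[in RHS](coefK p) /g !poly_def.
  rewrite (raddf_sum (comp_poly _)) rmorph_sum; apply: eq_bigr => i _ /=.
  rewrite -!mul_polyC comp_polyM comp_polyC rmorphXn /= comp_polyX.
  by rewrite rmorphM rmorphXn /= -phi_d.
move/(congr1 (fun q : {poly D} => (size q).-1)).
rewrite size_comp_poly size_polyX /= => /eqP.
rewrite muln_eq1 => /andP [_ /eqP].
by case: (size _) => //= ? ->.
Qed.

(** Modulo every prime ideal phi 'X has degree exactly one.  Hence its
coefficient of degree one lies in no prime ideal and is invertible, while the
higher ones lie in all of them and are nilpotent. *)
Lemma quasilinear_image_polyX (S : comNzRingType)
    (phi : {rmorphism {poly R} -> {poly S}}) : surjective phi ->
  invertible (phi 'X)`_1 /\ forall i, nilpot (phi 'X)`_i.+2.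
Proof.
move=> surj_phi; set f := phi 'X.
have sizef (D : idomainType) (pi : {rmorphism S -> D}) :
    surjective pi -> size (map_poly pi f) = 2%N.
  move=> surj_pi; apply: (size_image_polyX (phi := map_poly pi \o phi)) => q.
  have [g gK] := choice surj_pi.
  have [p phi_p] := surj_phi (\poly_(i < size q) g q`_i).
  exists p; rewrite /= phi_p; apply/polyP => i.
  rewrite coef_map coef_poly; case: ltnP => [_|le_qi]; first exact: gK.
  by rewrite raddf0 nth_default.
split=> [|i].
  apply: contrapT => f1; pose I x := exists y, x = f`_1 * y.
  have idI : left_ideal I.
    split=> [|_ _ [y ->] [z ->]|a _ [y ->]].
    - by exists 0; rewrite mulr0.
    - by exists (y + z); rewrite mulrDr.
    - by exists (a * y); rewrite mulrCA.
  have [|D [pi [surj_pi pi_I _]]] := domain_avoiding (x := 1) idI.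
    by move=> n [y]; rewrite expr1n => e; apply: f1; exists y.
  have /pi_I/eqP : I f`_1 by exists 1; rewrite mulr1.
  (* The coefficient of degree one is the leading one. *)
  rewrite -coef_map -[1%N]/(2.-1) -(sizef D pi surj_pi).
  by rewrite -/(lead_coef _) lead_coef_eq0 -size_poly_eq0 sizef.
apply: contrapT => nf.
have id0 : left_ideal [set (0 : S)].
  by split=> [|x y /= -> ->|a x /= ->]; rewrite /= ?addr0 ?mulr0.
have [n /= fn|D [pi [surj_pi _]]] := domain_avoiding (x := f`_i.+2) id0.
  by apply: nf; exists n.
by rewrite -coef_map nth_default ?eqxx // sizef.
Qed.

Lemma image_polyX_factor (S : comNzRingType)
    (phi : {rmorphism {poly R} -> {poly S}}) : surjective phi ->
  exists c g, phi 'X = ('X - c%:P) * g /\ invertible g.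
Proof.
by move=> /quasilinear_image_polyX [f1 nf]; apply: quasilinear_factor.
Qed.
End PiRegular.

(** * Equivalences of module categories are additive *)

Definition linear_map (R : pzRingType) (M N : lmodType R) (f : M -> N)
    (lin_f : linear f) : {linear M -> N} :=
  HB.pack f (GRing.isLinear.Build R M N *:%R f lin_f).

Section ModuleMaps.
Variables (k : fieldType) (A : algType k).

Definition regular_module : rmodType A := ((A : nzRingType)^c)^o.

Section Maps.
Variable M : rmodType A.

Fact element_map_linear (y : M) :
  linear (fun a : regular_module => (a : A^c) *: y).
Proof. by move=> a x z; rewrite scalerDl scalerA. Qed.

Definition element_map (y : M) : {linear regular_module -> M} :=
  linear_map (element_map_linear y).

Lemma element_mapE y (a : A^c) : element_map y a = a *: y.
Proof. by []. Qed.

Fact central_map_linear (z : center A) :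
  linear (fun x : M => (val z : A^c) *: x).
Proof.
move=> a x y; rewrite scalerDr !scalerA; congr (_ *: _ + _).
by have /asboolP/(_ a) := center_valP z; apply: esym.
Qed.

Definition central_map (z : center A) : {linear M -> M} :=
  linear_map (central_map_linear z).

Lemma central_mapE z x : central_map z x = (val z : A^c) *: x.
Proof. by []. Qed.

Implicit Types (z : center A) (x : M).

Lemma central_map1 x : central_map 1 x = x.
Proof. exact: scale1r. Qed.

Lemma central_mapB z z' x :
  central_map (z - z') x = central_map z x - central_map z' x.
Proof. by rewrite !central_mapE rmorphB /= scalerBl. Qed.

Lemma central_mapM z z' x :
  central_map (z * z') x = central_map z (central_map z' x).
Proof. by rewrite center_mulC !central_mapE scalerA rmorphM. Qed.
End Maps.

Lemma central_map_nat (M N : rmodType A) (f : {linear M -> N}) z x :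
  f (central_map M z x) = central_map N z (f x).
Proof. exact: linearZ. Qed.

Lemma regular_scale_inj (a b : A^c) :
  a *: (1 : regular_module) = b *: (1 : regular_module) -> a = b.
Proof. by move=> e; rewrite -[a]mulr1 -[b]mulr1; apply: e. Qed.
End ModuleMaps.

Lemma is_equivalence_faithful (k : fieldType) (C D : algType k)
    (F : functor C D) : is_equivalence F ->
  forall (M N : rmodType C) (f g : {linear M -> N}),
    fmap F f =1 fmap F g -> f =1 g.
Proof.
move=> [G [[eta [eps [_ epsK nat_eta]]] _]] M N f g eq_fg x.
rewrite -[x]epsK -[f _]/((f \o _) _) -[g _]/((g \o _) _).
rewrite -(nat_eta _ _ f) -(nat_eta _ _ g) /=; congr (eta _ _).
exact: (fmap_ext G eq_fg).
Qed.

Lemma fmap_factor (k : fieldType) (C D : algType k) (F : functor C D)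
    (M N P : rmodType C) (g : {linear N -> P}) (f : {linear M -> N})
    (h : {linear M -> P}) :
  (forall x, g (f x) = h x) -> forall y, fmap F g (fmap F f y) = fmap F h y.
Proof.
move=> gf y; rewrite -[LHS](fmap_comp F g f y).
by apply: (fmap_ext F) => x; apply: gf.
Qed.

Section Equivalence.
Variables (k : fieldType) (C D : algType k) (F : functor C D).
Hypothesis equivF : is_equivalence F.

(** An element of F M is a map from the regular module D to F M, and a
quasi-inverse G turns it into a map from G D to M.  Equations between elements
of F M can thus be checked on maps into M, where sums are pointwise, before
anything is known about F and sums. *)
Lemma is_equivalence_representable :
  exists (K : rmodType C) (rep : forall M : rmodType C, F M -> {linear K -> M}),
    (forall (M N : rmodType C) (f : {linear M -> N}) y,
       rep N (fmap F f y) =1 f \o rep M y) /\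
    (forall M y y', rep M y =1 rep M y' -> y = y').
Proof.
have [G [[eta [eps [etaK epsK nat_eta]]] FG_id]] := equivF.
have G_equiv : is_equivalence G.
  by exists F; split => //; exists eta, eps.
exists (G (regular_module D)).
exists (fun M y => eta M \o fmap G (element_map y)); split.
  move=> M N f y x /=; rewrite -[f _]/((f \o _) _).
  rewrite -(nat_eta _ _ f) /=; congr (eta _ _).
  rewrite -[RHS](fmap_comp G); apply: (fmap_ext G) => d.
  exact/esym/linearZ.
move=> M y y' eq_rep.
rewrite -[y]scale1r -[y']scale1r.
apply: (is_equivalence_faithful G_equiv (f := element_map y)
  (g := element_map y')) => x.
exact: (can_inj (etaK M)) (eq_rep x).
Qed.

Lemma fmap_zero (M N : rmodType C) (f : {linear M -> N}) :
  (forall x, f x = 0) -> forall y, fmap F f y = 0.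
Proof.
move=> f0 y; have [K [rep [nat_rep rep_inj]]] := is_equivalence_representable.
rewrite -[RHS](linear0 (fmap F f)); apply: rep_inj => x.
by rewrite !nat_rep /= !f0.
Qed.

Lemma fmap_zero_inv (M N : rmodType C) (f : {linear M -> N}) :
  (forall y, fmap F f y = 0) -> forall x, f x = 0.
Proof.
move=> Ff0; pose z : {linear M -> N} := \0.
apply: (is_equivalence_faithful equivF (g := z)) => y.
by rewrite Ff0 fmap_zero.
Qed.

(** The sum of f and g is the composite of (f, g) : M -> N * N with the addition
N * N -> N.  As F maps N * N to a biproduct of two copies of F N, it sends the
addition of N to that of F N. *)
Lemma fmap_add (M N : rmodType C) (f g h : {linear M -> N}) :
  (forall x, h x = f x + g x) -> forall y, fmap F h y = fmap F f y + fmap F g y.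
Proof.
move=> hE y; have [K [rep [nat_rep rep_inj]]] := is_equivalence_representable.
pose NN : rmodType C := (N * N)%type.
have lin_pair : linear (fun x => (f x, g x) : NN).
  by move=> a x x'; rewrite !linearP.
have lin_inl : linear (fun x => (x, 0) : NN).
  by move=> a x x'; congr pair; rewrite /= ?scaler0 ?addr0.
have lin_inr : linear (fun x => (0, x) : NN).
  by move=> a x x'; congr pair; rewrite /= ?scaler0 ?addr0.
have lin_add : linear (fun x : NN => x.1 + x.2).
  by move=> a x x'; rewrite /= scalerDr addrACA.
pose pair_map : {linear M -> NN} := linear_map lin_pair.
pose inl_map : {linear N -> NN} := linear_map lin_inl.
pose inr_map : {linear N -> NN} := linear_map lin_inr.
pose add_map : {linear NN -> N} := linear_map lin_add.
pose fst_map : {linear NN -> N} := fst.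
pose snd_map : {linear NN -> N} := snd.
have joint_inj (u v : F NN) : fmap F fst_map u = fmap F fst_map v ->
    fmap F snd_map u = fmap F snd_map v -> u = v.
  move=> eq1 eq2; apply: rep_inj => x.
  have := nat_rep _ _ fst_map u x; have := nat_rep _ _ snd_map u x.
  rewrite eq1 eq2 !nat_rep /=.
  by case: (rep _ u x) => a b; case: (rep _ v x) => a' b' /= -> ->.
have idN (p : {linear N -> N}) :
    (forall x, p x = x) -> forall z, fmap F p z = z.
  move=> pid z; rewrite -[RHS](fmap_id F N z).
  by apply: (fmap_ext F) => x; apply: pid.
have split_pair (u : F NN) :
    u = fmap F inl_map (fmap F fst_map u) + fmap F inr_map (fmap F snd_map u).
  apply: joint_inj; rewrite linearD.
    rewrite (fmap_factor (h := idfun)) //= idN //.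
    by rewrite (fmap_factor (h := \0)) //= (fmap_zero (f := \0)) // addr0.
  rewrite (fmap_factor (h := \0)) //= (fmap_zero (f := \0)) // add0r.
  by rewrite (fmap_factor (h := idfun)) //= idN //.
rewrite -(fmap_factor (f := pair_map) (g := add_map)); last first.
  by move=> x; rewrite hE.
rewrite [fmap F pair_map y]split_pair linearD.
rewrite (fmap_factor (f := pair_map) (h := f)) //.
rewrite (fmap_factor (f := pair_map) (h := g)) //.
rewrite !(fmap_factor (g := add_map) (h := idfun)) /=; last 2 first.
- by move=> x; rewrite /= add0r.
- by move=> x; rewrite /= addr0.
by rewrite !idN.
Qed.

(** The center of a ring is the ring of natural endomorphisms of the identity
functor of its modules, and so an equivalence carries a central z to a central
w.  Here w is the value at 1 of the action of z on the regular module D,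
identified with F (G D); it governs all modules because every element of F M is
the image of 1 under a map from D. *)
Lemma fmap_central_map (z : center C) :
  exists w : center D,
    forall (M : rmodType C) y,
      fmap F (central_map M z) y = central_map (F M) w y.
Proof.
have [G [GF_id FG_id]] := equivF.
have [eta [eps [etaK epsK nat_eta]]] := GF_id.
have [eta' [eps' [etaK' epsK' nat_eta']]] := FG_id.
have central_nat (M N : rmodType C) (f : {linear M -> N}) (u : F M) :
    fmap F (central_map N z) (fmap F f u) =
    fmap F f (fmap F (central_map M z) u).
  rewrite -[RHS](fmap_comp F).
  by apply: fmap_factor => x; rewrite /= !central_mapE linearZ.
pose DD := regular_module D; pose K := G DD.
pose w : D := eta' DD (fmap F (central_map K z) (eps' DD 1)).
have wE (M : rmodType C) (y : F M) :
    fmap F (central_map M z) y = (w : D^c) *: y.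
  (* The automorphism of F M made of the two given isomorphisms may fail to be
     the identity, so y has to be corrected by its inverse. *)
  have [t ty] : exists t : F M, fmap F (eta M) (eps' (F M) t) = y.
    exists (eta' (F M) (fmap F (eps M) y)).
    rewrite etaK' (fmap_factor (h := idfun)); last by move=> x; apply: epsK.
    by rewrite fmap_id.
  have gE (d : D^c) :
      fmap F (eta M) (fmap F (fmap G (element_map t)) (eps' DD d)) = d *: y.
    rewrite -ty -2!linearZ; congr (fmap F _ _); apply: (can_inj (etaK' _)).
    rewrite epsK'.
    by have /= -> := nat_eta' _ _ (element_map t) (eps' DD d); rewrite epsK'.
  rewrite -[in LHS](scale1r y) -(gE 1) !central_nat -gE /w.
  by rewrite etaK'.
have w_central : w \in @central_pred D.
  apply/asboolP => d; pose u := eps' DD 1.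
  have : (w : D^c) *: ((d : D^c) *: u) = (d : D^c) *: ((w : D^c) *: u).
    by rewrite -!wE linearZ.
  rewrite !scalerA => /(congr1 (eta' DD)).
  by rewrite !linearZ /u epsK' => /regular_scale_inj.
exists (Center w_central) => M y; exact: wE.
Qed.
End Equivalence.

(** * Transport of the center *)

(** The central element of D attached to z is unique, which makes it compatible
with products and, as F is additive, with sums.  A quasi-inverse of F provides
the preimages. *)
Lemma center_transfer (k : fieldType) (C D : algType k) (F : functor C D) :
  is_equivalence F ->
  exists tau : {rmorphism center C -> center D}, surjective tau /\
    forall z (M : rmodType C) y,
      fmap F (central_map M z) y = central_map (F M) (tau z) y.
Proof.
move=> equivF; have [t tE] := choice (fmap_central_map equivF).
have [G [GF_id [eta [eps [etaK epsK nat_eta]]]]] := equivF.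
have equivG : is_equivalence G.
  by exists F; split=> //; exists eta, eps.
pose DD := regular_module D; pose K := G DD.
(* D acts faithfully on F K, which is isomorphic to the regular module. *)
have uniq (w w' : center D) :
    (forall y : F K, central_map (F K) w y = central_map (F K) w' y) -> w = w'.
  move=> eq_ww'; apply: val_inj.
  have /(congr1 (eta DD)) := eq_ww' (eps DD 1).
  by rewrite !central_mapE !linearZ epsK => /regular_scale_inj.
have t_zmod : zmod_morphism t.
  move=> z z'; apply: uniq => y; apply/eqP.
  rewrite central_mapB eq_sym subr_eq -!tE; apply/eqP.
  apply: (fmap_add equivF) => x.
  by rewrite central_mapB subrK.
have t_monoid : monoid_morphism t.
  split=> [|z z']; apply: uniq => y; rewrite -tE.
    rewrite central_map1 -[RHS](fmap_id F); apply: (fmap_ext F) => x.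
    exact: central_map1.
  rewrite central_mapM -!tE; symmetry; apply: fmap_factor => x.
  by rewrite central_mapM.
pose tau : {rmorphism center C -> center D} := HB.pack t
  (GRing.isZmodMorphism.Build _ _ t t_zmod)
  (GRing.isMonoidMorphism.Build _ _ t t_monoid).
exists tau; split=> [w|z M y]; last exact: tE.
have [z zE] := fmap_central_map equivG w.
exists z; apply: uniq => y; rewrite -tE.
rewrite (fmap_ext F (g := fmap G (central_map DD w))) => [|x]; last first.
  by rewrite zE.
apply: (can_inj (etaK _)); rewrite central_map_nat.
exact: (nat_eta _ _ (central_map DD w) y).
Qed.

Section PolyCenter.
Variable A : nzRingType.

Definition center_poly (p : {poly center A}) : {poly A} :=
  map_poly (val : center A -> A) p.

Lemma center_poly_central p : center_poly p \in @central_pred {poly A}.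
Proof.
apply/asboolP => q; apply/polyP => i; rewrite coefM coefMr.
apply: eq_bigr => j _; rewrite coef_map /=.
by have /asboolP := center_valP p`_j; apply.
Qed.

Definition poly_center_fun p : center {poly A} :=
  Center (center_poly_central p).

Fact poly_center_is_zmod_morphism : zmod_morphism poly_center_fun.
Proof. by move=> p q; apply: val_inj; rewrite /= /center_poly rmorphB. Qed.
Fact poly_center_is_monoid_morphism : monoid_morphism poly_center_fun.
Proof.
by split=> [|p q]; apply: val_inj; rewrite /= /center_poly ?rmorph1 ?rmorphM.
Qed.
HB.instance Definition _ := GRing.isZmodMorphism.Build _ _ poly_center_fun
  poly_center_is_zmod_morphism.
HB.instance Definition _ := GRing.isMonoidMorphism.Build _ _ poly_center_fun
  poly_center_is_monoid_morphism.
Definition poly_center : {rmorphism {poly center A} -> center {poly A}} :=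
  poly_center_fun.

Lemma poly_centerE p : val (poly_center p) = map_poly (val : center A -> A) p.
Proof. by []. Qed.

(** A polynomial that commutes with the constants has central coefficients. *)
Lemma poly_center_bij : bijective poly_center.
Proof.
have poly_center_inj : injective poly_center.
  move=> p q /(congr1 val) /= eq_pq; apply/polyP => i; apply: val_inj.
  by have := congr1 (coefp i) eq_pq; rewrite /= !coef_map.
suff /choice [g gK] : forall q, exists p, poly_center p = q.
  by exists g => // p; apply: poly_center_inj; rewrite gK.
move=> [q q_centralP]; have /asboolP q_central := q_centralP.
have coef_central i : q`_i \in @central_pred A.
  apply/asboolP => a; have := congr1 (coefp i) (q_central a%:P).
  by rewrite /= coefMC coefCM.
exists (\poly_(i < size q) Center (coef_central i)); apply: val_inj.
apply/polyP => i; rewrite /= coef_map coef_poly.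
by case: ltnP => // le_qi; rewrite nth_default.
Qed.
End PolyCenter.

Lemma poly_center_transfer (k : fieldType) (A B : algType k)
    (F : functor (polyalg A) (polyalg B)) : is_equivalence F ->
  exists phi : {rmorphism {poly center A} -> {poly center B}}, surjective phi /\
    forall p (M : rmodType (polyalg A)) y,
      fmap F (central_map M (poly_center A p)) y =
      central_map (F M) (poly_center B (phi p)) y.
Proof.
move=> /center_transfer [tau [surj_tau tauE]].
have [g poly_centerK gK] := poly_center_bij B.
have [h poly_centerK' hK] := poly_center_bij A.
pose gm : {rmorphism center {poly B} -> {poly center B}} := HB.pack g
  (GRing.isZmodMorphism.Build _ _ g (can2_zmod_morphism poly_centerK gK))
  (GRing.isMonoidMorphism.Build _ _ g (can2_monoid_morphism poly_centerK gK)).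
exists (gm \o tau \o poly_center A); split=> [q|p M y].
  have [z zq] := surj_tau (poly_center B q).
  by exists (h z); rewrite /= hK zq poly_centerK.
by rewrite tauE; congr (central_map _ _ y); apply/esym/gK.
Qed.

(** * Natural isomorphisms and restriction of scalars *)

Section NatIso.
Variables (k : fieldType) (A B C : algType k).

Lemma nat_iso_trans (F G H : functor A B) :
  nat_iso F G -> nat_iso G H -> nat_iso F H.
Proof.
move=> [e [d [eK dK nat_e]]] [e' [d' [eK' dK' nat_e']]].
exists (fun M => e' M \o e M), (fun M => d M \o d' M).
split=> [M x|M x|M N f x] /=.
- by rewrite eK' eK.
- by rewrite dK dK'.
- by have /= -> := nat_e _ _ f x; apply: (nat_e' _ _ f).
Qed.

Lemma nat_iso_whisker_left (G : functor B C) (F F' : functor A B) :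
  nat_iso F F' -> nat_iso (functor_comp G F) (functor_comp G F').
Proof.
move=> [e [d [eK dK nat_e]]].
exists (fun M => fmap G (e M)), (fun M => fmap G (d M)).
split=> [M x|M x|M N f x] /=.
- by rewrite (fmap_factor (h := idfun)) ?fmap_id //; apply: eK.
- by rewrite (fmap_factor (h := idfun)) ?fmap_id //; apply: dK.
- rewrite -[RHS](fmap_comp G).
  by apply: (fmap_factor (F := G)) => y; apply: (nat_e M N f y).
Qed.

Lemma nat_iso_whisker_right (G G' : functor B C) (F : functor A B) :
  nat_iso G G' -> nat_iso (functor_comp G F) (functor_comp G' F).
Proof.
move=> [e [d [eK dK nat_e]]].
exists (fun M => e (F M)), (fun M => d (F M)).
by split=> [M|M|M N f]; [apply: eK|apply: dK|apply: (nat_e (F M) (F N))].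
Qed.

Lemma nat_iso_unitl (F : functor A B) :
  nat_iso (functor_comp (functor_id B) F) F.
Proof. by exists (fun M => idfun), (fun M => idfun). Qed.

Lemma linear_functor_comp (G : functor B C) (F : functor A B) :
  linear_functor G -> linear_functor F -> linear_functor (functor_comp G F).
Proof. by move=> linG linF M N c f g h hE; apply/linG/linF. Qed.
End NatIso.

Section NatIsoAssoc.
Variables (k : fieldType) (A B C D : algType k).
Variables (H : functor C D) (G : functor B C) (F : functor A B).

Lemma nat_iso_assoc :
  nat_iso (functor_comp (functor_comp H G) F)
    (functor_comp H (functor_comp G F)).
Proof. by exists (fun M => idfun), (fun M => idfun). Qed.

Lemma nat_iso_assoc_inv :
  nat_iso (functor_comp H (functor_comp G F))
    (functor_comp (functor_comp H G) F).
Proof. by exists (fun M => idfun), (fun M => idfun). Qed.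
End NatIsoAssoc.

Section Restriction.
Variables (R S : nzRingType) (g : {rmorphism R -> S}).

Definition restricted (M : rmodType S) : Type := M.

Section Module.
Variable M : rmodType S.
HB.instance Definition _ := GRing.Zmodule.on (restricted M).

Definition restr_scale (a : R^c) (x : restricted M) : restricted M :=
  (g a : S^c) *: (x : M).

Fact restr_scaleA a b x :
  restr_scale a (restr_scale b x) = restr_scale (a * b) x.
Proof.
by rewrite /restr_scale scalerA -[a * b]/((b : R) * a) rmorphM.
Qed.

Fact restr_scale1 : left_id 1 restr_scale.
Proof. by move=> x; rewrite /restr_scale rmorph1 scale1r. Qed.

Fact restr_scaleDr : right_distributive restr_scale +%R.
Proof. by move=> a x y; apply: scalerDr. Qed.

Fact restr_scaleDl x : {morph restr_scale^~ x : a b / a + b}.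
Proof. by move=> a b; rewrite /restr_scale rmorphD scalerDl. Qed.

HB.instance Definition _ := GRing.Zmodule_isLmodule.Build R^c (restricted M)
  restr_scaleA restr_scale1 restr_scaleDr restr_scaleDl.
End Module.

Definition restr_module (M : rmodType S) : rmodType R := restricted M.

Lemma restr_scaleE (M : rmodType S) (a : R^c) (x : restr_module M) :
  a *: x = (g a : S^c) *: (x : M).
Proof. by []. Qed.

Section Map.
Variables (M N : rmodType S) (f : {linear M -> N}).
Fact restr_map_linear :
  linear (f : restr_module M -> restr_module N).
Proof. by move=> a x y; rewrite linearP. Qed.

Definition restr_map : {linear restr_module M -> restr_module N} :=
  linear_map restr_map_linear.
End Map.
End Restriction.

Section RestrictionFunctor.
Variables (k : fieldType) (A B : algType k) (g : {rmorphism A -> B}).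

Definition restriction : functor B A :=
  @Functor k B A (restr_module g) (fun M N f => restr_map g f)
    (fun M N f f' e => e) (fun M x => erefl) (fun M N P f f' x => erefl).

Lemma restriction_linear :
  (forall a : k, g a%:A = a%:A) -> linear_functor restriction.
Proof.
move=> gA M N c f f' h hE y; rewrite restr_scaleE gA.
exact: (hE y).
Qed.
End RestrictionFunctor.

(** * Modules on which the indeterminate acts as a central scalar *)

Section Evaluation.
Variables (k : fieldType) (A : algType k).

Lemma center_commr (c : center A) : commr_rmorph idfun (val c).
Proof. by have /asboolP := center_valP c. Qed.

Definition eval_at (c : center A) : {rmorphism polyalg A -> A} :=
  horner_morph (center_commr c).

(** The A-modules, seen as the A[t]-modules on which t acts as c. *)
Definition at_value (c : center A) : functor A (polyalg A) :=
  restriction (eval_at c).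

Definition forget_t : functor (polyalg A) A :=
  restriction (polyC : {rmorphism A -> polyalg A}).

Lemma eval_atC c a : eval_at c (a%:P : polyalg A) = a.
Proof. exact: horner_morphC. Qed.

Lemma eval_atX c : eval_at c ('X : polyalg A) = val c.
Proof. exact: horner_morphX. Qed.

Lemma alg_polyalg (a : k) : (a%:A : polyalg A) = (a%:A : A)%:P.
Proof. exact: alg_polyC. Qed.

Lemma forget_t_linear : linear_functor forget_t.
Proof. by apply: restriction_linear => a; rewrite alg_polyalg. Qed.

Lemma at_value_linear c : linear_functor (at_value c).
Proof. by apply: restriction_linear => a; rewrite alg_polyalg eval_atC. Qed.

Definition t_acts_as (c : center A) (N : rmodType (polyalg A)) : Prop :=
  forall x : N, central_map N (poly_center A ('X - c%:P)) x = 0.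

Lemma t_acts_as_inj (c : center A) (N N' : rmodType (polyalg A))
    (f : {linear N -> N'}) : injective f -> t_acts_as c N' -> t_acts_as c N.
Proof.
by move=> inj_f N'c x; apply: inj_f; rewrite central_map_nat N'c linear0.
Qed.

Lemma val_poly_centerXsubC (c : center A) :
  val (poly_center A ('X - c%:P)) = 'X - (val c)%:P.
Proof. by rewrite poly_centerE map_polyXsubC. Qed.

Lemma at_value_t (c : center A) (M : rmodType A) : t_acts_as c (at_value c M).
Proof.
move=> x; rewrite central_mapE val_poly_centerXsubC restr_scaleE.
by rewrite rmorphB /= eval_atX eval_atC subrr scale0r.
Qed.

Lemma forget_at_value (c : center A) :
  nat_iso (functor_comp forget_t (at_value c)) (functor_id A).
Proof.
pose E := functor_comp forget_t (at_value c).
have scaleE (M : rmodType A) (a : A^c) (x : M) : a *: (x : E M) = a *: x.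
  by rewrite !restr_scaleE eval_atC.
have lin1 (M : rmodType A) : linear (idfun : E M -> M).
  by move=> a x y; rewrite scaleE.
have lin2 (M : rmodType A) : linear (idfun : M -> E M).
  by move=> a x y; rewrite scaleE.
exists (fun M => linear_map (lin1 M)).
exists (fun M => linear_map (lin2 M)).
by [].
Qed.

(** If t acts as c then p and the constant p(c) act alike, because p - p(c) is a
multiple of 'X - c.  The functor E restricts attention to modules with this
property. *)
Lemma at_value_forget (K : algType k) (E : functor K (polyalg A))
    (c : center A) :
  (forall M, t_acts_as c (E M)) ->
  nat_iso (functor_comp (functor_comp (at_value c) forget_t) E) E.
Proof.
move=> Ec; pose E' := functor_comp (functor_comp (at_value c) forget_t) E.
have scaleE M (p : (polyalg A)^c) (x : E M) : p *: (x : E' M) = p *: x.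
  pose e : {poly A} := (eval_at c p)%:P.
  have /factor_theorem [q pq] : root (p - e : {poly A}) (val c).
    rewrite /root hornerD hornerN hornerC /= /horner_morph map_poly_id //.
    by rewrite subrr.
  have pE : (p : {poly A}) = e + q * ('X - (val c)%:P).
    by rewrite -pq addrC subrK.
  rewrite !restr_scaleE [in RHS]pE.
  have -> : ((e + q * ('X - (val c)%:P) : {poly A}) : (polyalg A)^c) *: x =
      (e : (polyalg A)^c) *: x + central_map (E M) (poly_center A ('X - c%:P))
        ((q : (polyalg A)^c) *: x).
    by rewrite central_mapE val_poly_centerXsubC scalerA -scalerDl.
  by rewrite Ec addr0.
have lin1 M : linear (idfun : E' M -> E M).
  by move=> a x y; rewrite scaleE.
have lin2 M : linear (idfun : E M -> E' M).
  by move=> a x y; rewrite scaleE.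
exists (fun M => linear_map (lin1 M)).
exists (fun M => linear_map (lin2 M)).
by [].
Qed.
End Evaluation.

(** * Cancellation *)

Section Cancellation.
Variable k : fieldType.

Definition descend (A B : algType k) (F : functor (polyalg A) (polyalg B))
    (a : center A) : functor A B :=
  functor_comp (forget_t B) (functor_comp F (at_value a)).

Lemma descend_linear (A B : algType k) (F : functor (polyalg A) (polyalg B)) a :
  linear_functor F -> linear_functor (descend F a).
Proof.
move=> linF; apply: linear_functor_comp; first exact: forget_t_linear.
by apply: linear_functor_comp => //; apply: at_value_linear.
Qed.

Lemma descend_comp (A B : algType k) (F : functor (polyalg A) (polyalg B))
    (G : functor (polyalg B) (polyalg A)) (a : center A) (b : center B) :
  nat_iso (functor_comp G F) (functor_id (polyalg A)) ->
  (forall M, t_acts_as b (F (at_value a M))) ->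
  nat_iso (functor_comp (descend G b) (descend F a)) (functor_id A).
Proof.
move=> GF_id Fab.
(* At M the composite is the A-module underlying G of F (at_value a M) with the
   action of t forgotten and restored; this changes nothing by Fab. *)
apply: (nat_iso_trans _ (forget_at_value a)).
apply: (nat_iso_trans (nat_iso_assoc _ _ _)); apply: nat_iso_whisker_left.
apply: (nat_iso_trans (nat_iso_assoc _ _ _)).
have middle : nat_iso (functor_comp (at_value b) (functor_comp (forget_t B)
    (functor_comp F (at_value a)))) (functor_comp F (at_value a)).
  apply: (nat_iso_trans (nat_iso_assoc_inv _ _ _)).
  exact: (at_value_forget (E := functor_comp F (at_value a))).
apply: (nat_iso_trans (nat_iso_whisker_left G middle)).
apply: (nat_iso_trans (nat_iso_assoc_inv _ _ _)).
exact: nat_iso_trans (nat_iso_whisker_right _ GF_id) (nat_iso_unitl _).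
Qed.

(** The two cases of descend_comp apply because phi 'X generates the same ideal
as 'X - b: F and its quasi-inverse match the modules killed by 'X with those
killed by phi 'X, that is with those on which t acts as b. *)
Lemma cancellation (A B : algType k) (F : functor (polyalg A) (polyalg B)) :
  pi_regular (center A) -> is_equivalence F ->
  exists a, is_equivalence (descend F a).
Proof.
move=> regA equivF.
have [phi [surj_phi phiE]] := poly_center_transfer equivF.
have [b [g [phiX [h gh]]]] := image_polyX_factor regA surj_phi.
have [G [GF_id FG_id]] := equivF.
exists 0, (descend G b); split; apply: descend_comp => // M x.
  have -> : 'X - b%:P = h * phi 'X.
    by rewrite phiX mulrCA [h * g]mulrC gh mulr1.
  rewrite rmorphM central_mapM -phiE fmap_zero ?linear0 // => y.
  by have := at_value_t y; rewrite polyC0 subr0.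
rewrite polyC0 subr0; apply: (fmap_zero_inv equivF) => y.
rewrite phiE phiX mulrC rmorphM central_mapM.
have [eta [eps [etaK _ _]]] := FG_id.
have tG : t_acts_as b (F (G (at_value b M))).
  exact: t_acts_as_inj (can_inj (etaK _)) (at_value_t (M := M)).
by rewrite tG linear0.
Qed.

Lemma artinian_pi_regular (R : comNzRingType) : artinian R -> pi_regular R.
Proof.
move=> artR x; pose I n : set R := [set y | exists a, y = x ^+ n * a].
have idI n : left_ideal (I n).
  split=> [|_ _ [a ->] [b ->]|b _ [a ->]].
  - by exists 0; rewrite mulr0.
  - by exists (a + b); rewrite mulrDr.
  - by exists (b * a); rewrite mulrCA.
have [|n In] := artR I idI.
  by move=> n _ [a ->]; exists (x * a); rewrite mulrA -exprSr.
have [a xn] : I n.+1 (x ^+ n) by rewrite In //; exists 1; rewrite mulr1.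
by exists n, a.
Qed.

Lemma scale_central (A : algType k) (c : k) (x : A) :
  x \in @central_pred A -> c *: x \in @central_pred A.
Proof.
move=> /asboolP Zx; apply/asboolP => y.
by rewrite /GRing.comm -scalerAl -scalerAr Zx.
Qed.

(** The powers of x are linearly dependent, so some power of x is a linear
combination of higher ones. *)
Lemma falg_center_pi_regular (A : falgType k) : pi_regular (center A).
Proof.
move=> x; set m := (\dim {:A}).+1.
pose X := [tuple of mkseq (fun i => val x ^+ i) m].
have : ~~ free X.
  by rewrite /free size_tuple neq_ltn ltnS dimvS ?subvf.
rewrite freeNE => /existsP [i]; rewrite nth_mkseq //.
have nth_dropX j : (j < size (drop i.+1 X))%N ->
    (drop i.+1 X)`_j = val x ^+ i.+1 * val x ^+ j.
  rewrite size_drop size_tuple ltn_subRL => lt_jm.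
  by rewrite nth_drop nth_mkseq // exprD.
move/(coord_span (X := in_tuple (drop i.+1 X))).
pose y := \sum_(j < size (drop i.+1 X))
  coord (in_tuple (drop i.+1 X)) j (val x ^+ i) *: val x ^+ j.
have yZ : y \in @central_pred A.
  by apply: rpred_sum => j _; apply: scale_central; rewrite rpredX // (valP x).
move=> xiE; exists i, (Center yZ); apply: val_inj.
rewrite rmorphM !rmorphXn /= [LHS]xiE mulr_sumr; apply: eq_bigr => j _.
by rewrite nth_dropX // scalerAr.
Qed.
End Cancellation.

Lemma pi_regular_morita_cancellative (k : fieldType) (A : algType k) :
  pi_regular (center A) ->
  morita_cancellative A /\ klinear_morita_cancellative A.
Proof.
move=> regA; split=> B.
  by move=> [F /(cancellation regA) [a Fa]]; exists (descend F a).
move=> [F [linF /(cancellation regA) [a Fa]]]; exists (descend F a).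
by split=> //; apply: descend_linear.
Qed.

Theorem theorem0p4 (k : fieldType) :
  (forall A : algType k,
     left_noetherian A \/ right_noetherian A ->
     artinian (center A) ->
     morita_cancellative A /\ klinear_morita_cancellative A) /\
  (forall A : falgType k,
     morita_cancellative A /\ klinear_morita_cancellative A).
Proof.
split=> [A _ artA|A]; apply: pi_regular_morita_cancellative.
  exact: artinian_pi_regular.
exact: falg_center_pi_regular.
Qed.
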